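(* Let $(A,m,\Delta)$ be a bialgebra over $\mathbb{K}$, not necessarily unitary nor counitary. Define $\Phi\colon A\otimes A\longrightarrow A\otimes A$ by \[\Phi(a\otimes b)=(m\otimes\mathrm{Id}_A)\circ(\mathrm{Id}_A\otimes\tau)\circ(\Delta\otimes\mathrm{Id}_A)(a\otimes b)=\sum a^{(1)}b\otimes a^{(2)}\] for any $a,b\in A$. Then $(A,\Phi)$ is an $\ell$EAS.
   Context: $\mathbb{K}$ is a commutative field, all vector spaces are over $\mathbb{K}$, $\tau(x\otimes y)=y\otimes x$, and $\Delta(a)=\sum a^{(1)}\otimes a^{(2)}$ is Sweedler's notation. A bialgebra not necessarily unitary nor counitary is a vector space with an associative product $m$ and a coassociative coproduct $\Delta$ which is multiplicative, $\Delta(xy)=\Delta(x)\Delta(y)$. A linear extended associative semigroup ($\ell$EAS) is a pair $(A,\Phi)$ where $A$ is a vector space and $\Phi\colon A\otimes A\to A\otimes A$ is a linear map with \[(\mathrm{Id}\otimes\Phi)\circ(\Phi\otimes\mathrm{Id})\circ(\mathrm{Id}\otimes\Phi)=(\Phi\otimes\mathrm{Id})\circ(\mathrm{Id}\otimes\tau)\circ(\Phi\otimes\mathrm{Id}).\] *)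

(* Defs.v *)
From HB Require Import structures.
From mathcomp Require Import all_boot all_order all_algebra.
From mathcomp Require Import boolp freeg.

Set Implicit Arguments.
Unset Strict Implicit.
Unset Printing Implicit Defensive.

Import GRing.Theory.
Local Open Scope ring_scope.
Local Open Scope quotient_scope.

Reserved Notation "A ⊗ B" (at level 40, left associativity).
Reserved Notation "a *t b" (at level 40, left associativity).

(* The tensor product of two vector spaces: the free vector space on [A * B]
   modulo the bilinearity relations. *)
Section Tensor.
Variables (K : fieldType) (A B : lmodType K).

Local Notation free := {freeg (A * B)%type / K}.
Local Notation gen a b := (<< (a : A, b : B) >> : free).

Inductive tensor_relation : free -> Prop :=
| TensorDl a a' b : tensor_relation (gen (a + a') b - (gen a b + gen a' b))
| TensorDr a b b' : tensor_relation (gen a (b + b') - (gen a b + gen a b'))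
| TensorZl k a b : tensor_relation (gen (k *: a) b - k *: gen a b)
| TensorZr k a b : tensor_relation (gen a (k *: b) - k *: gen a b).

(* Subspace spanned by the relations: the intersection of all subspaces
   containing them. *)
Definition tensor_ker : {pred free} := fun x =>
  `[< forall S : {pred free}, submod_closed S ->
      (forall r, tensor_relation r -> r \in S) -> x \in S >].

Lemma tensor_ker_submod : submod_closed tensor_ker.
Proof.
split=> [|k u v /asboolP uI /asboolP vI]; apply/asboolP => S SI Sr.
  by case: SI.
by case: (SI) => _; apply; [exact: uI | exact: vI].
Qed.

HB.instance Definition _ :=
  GRing.isZmodClosed.Build free tensor_ker (GRing.submod_closedB tensor_ker_submod).

Definition tensor := Quotient.quot tensor_ker.
HB.instance Definition _ := GRing.Zmodule.on tensor.

Definition tensor_pi (x : free) : tensor := \pi_(Quotient.quot tensor_ker) x.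

Lemma tensor_piD x y : tensor_pi (x + y) = tensor_pi x + tensor_pi y.
Proof. by rewrite /tensor_pi [LHS]raddfD. Qed.

Lemma tensor_pi_eq x y : (tensor_pi x == tensor_pi y) = (x - y \in tensor_ker).
Proof. exact/esym/Quotient.idealrBE. Qed.

Lemma tensor_piK x : tensor_pi (repr x) = x.
Proof. exact: reprK. Qed.

Definition tensor_scale (k : K) (x : tensor) : tensor :=
  tensor_pi (k *: repr x).

Lemma tensor_kerZ k x : x \in tensor_ker -> k *: x \in tensor_ker.
Proof.
case: tensor_ker_submod => I0 IZ xI.
by have := IZ k x 0 xI I0; rewrite addr0.
Qed.

Lemma tensor_scaleE k x : tensor_scale k (tensor_pi x) = tensor_pi (k *: x).
Proof.
apply/eqP; rewrite tensor_pi_eq -scalerBr; apply: tensor_kerZ.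
by rewrite -tensor_pi_eq tensor_piK.
Qed.

Fact tensor_scaleA k l x :
  tensor_scale k (tensor_scale l x) = tensor_scale (k * l) x.
Proof. by rewrite -(tensor_piK x) !tensor_scaleE scalerA. Qed.

Fact tensor_scale1 : left_id 1 tensor_scale.
Proof. by move=> x; rewrite -(tensor_piK x) tensor_scaleE scale1r. Qed.

Fact tensor_scaleDr : right_distributive tensor_scale +%R.
Proof.
move=> k x y; rewrite -(tensor_piK x) -(tensor_piK y).
by rewrite -tensor_piD !tensor_scaleE scalerDr tensor_piD.
Qed.

Fact tensor_scaleDl x : {morph tensor_scale^~ x : k l / k + l}.
Proof.
by move=> k l; rewrite -(tensor_piK x) !tensor_scaleE scalerDl tensor_piD.
Qed.

HB.instance Definition _ := GRing.Zmodule_isLmodule.Build K tensor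
  tensor_scaleA tensor_scale1 tensor_scaleDr tensor_scaleDl.

Lemma tensor_piZ k x : tensor_pi (k *: x) = k *: tensor_pi x.
Proof. by rewrite -tensor_scaleE. Qed.

Definition tensor_pure (a : A) (b : B) : tensor := tensor_pi << (a, b) >>.

Lemma tensor_rel0 x y : tensor_relation (x - y) -> tensor_pi x = tensor_pi y.
Proof.
move=> xy; apply/eqP; rewrite tensor_pi_eq; apply/asboolP => S _; exact.
Qed.

Fact tensor_pure_bilinear : bilinear_for *:%R *:%R tensor_pure.
Proof.
split=> [b k a a' | a k b b']; rewrite /tensor_pure /=.
  by rewrite (tensor_rel0 (TensorDl _ _ _)) tensor_piD
     (tensor_rel0 (TensorZl _ _ _)) tensor_piZ.
by rewrite (tensor_rel0 (TensorDr _ _ _)) tensor_piD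
   (tensor_rel0 (TensorZr _ _ _)) tensor_piZ.
Qed.

HB.instance Definition _ :=
  bilinear_isBilinear.Build K A B tensor *:%R *:%R tensor_pure
    tensor_pure_bilinear.

End Tensor.

Arguments tensor_pure : simpl never.

Notation "A ⊗ B" := (tensor A B).
Notation "a *t b" := (tensor_pure a b) : ring_scope.

Section FgliftLinear.
Variables (K : fieldType) (T : choiceType) (W : lmodType K) (f : T -> W).

Lemma fglift_linear : linear (fglift f : {freeg T / K} -> W).
Proof.
have fgB : zmod_morphism (fglift f) := @lift_is_additive K T W f.
have fg0 : fglift f 0 = 0 by have := fgB 0 0; rewrite !subrr.
have fgD u v : fglift f (u + v) = fglift f u + fglift f v.
  by rewrite -{1}[v]opprK fgB -[- v]sub0r fgB fg0 sub0r opprK.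
have fgS (I : Type) (r : seq I) (F : I -> {freeg T / K}) :
    fglift f (\sum_(i <- r) F i) = \sum_(i <- r) fglift f (F i).
  by elim/big_rec2: _ => [|i u v _ <-]; [exact: fg0 | rewrite fgD].
move=> k x y; rewrite fgD; congr (_ + _).
transitivity (\sum_(z <- dom x) fglift f (k *: << coeff z x *g z >>)).
  by rewrite -fgS -scaler_sumr freeg_sumE.
transitivity (k *: \sum_(z <- dom x) fglift f << coeff z x *g z >>); last first.
  by rewrite -fgS freeg_sumE.
rewrite scaler_sumr; apply: eq_bigr => z _.
have -> : k *: << coeff z x *g z >> = << k * coeff z x *g z >> :> {freeg T / K}.
  by apply/eqP/freeg_eqP => t; rewrite coeffZ !coeffU mulrA.
by rewrite !liftU scalerA.
Qed.

HB.instance Definition _ :=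
  GRing.isLinear.Build K {freeg T / K} W *:%R (fglift f) fglift_linear.

End FgliftLinear.

Section Lift.
Variables (K : fieldType) (A B W : lmodType K).

Lemma tensor_ind (P : A ⊗ B -> Prop) :
  (forall a b, P (a *t b)) -> (forall x y, P x -> P y -> P (x + y)) ->
  (forall k x, P x -> P (k *: x)) -> forall x, P x.
Proof.
move=> Ppure PD PZ x; rewrite -(tensor_piK x) -[repr x]freeg_sumE.
have P0 : P 0 by rewrite -(scale0r (0 *t 0)); exact/PZ/Ppure.
elim: (dom _) => [|[a b] s IHs].
  by rewrite big_nil -(scale0r 0) tensor_piZ scale0r.
rewrite big_cons tensor_piD; apply: PD => //.
set c := coeff _ _.
have -> : << c *g (a, b) >> = c *: << (a, b) >> :> {freeg (A * B)%type / K}.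
  by apply/eqP/freeg_eqP => t; rewrite coeffZ !coeffU mul1r.
by rewrite tensor_piZ; exact/PZ/Ppure.
Qed.

Lemma tensor_ext (f g : {linear A ⊗ B -> W}) :
  (forall a b, f (a *t b) = g (a *t b)) -> f =1 g.
Proof.
move=> fg; apply: tensor_ind => [//|x y fgx fgy|k x fgx].
  by rewrite !linearD fgx fgy.
by rewrite !linearZ fgx.
Qed.

Variable f : {bilinear A -> B -> W}.

Let f' (p : A * B) : W := f p.1 p.2.

Definition tensor_lift (x : A ⊗ B) : W := fglift f' (repr x).

Lemma fglift_ker x : x \in @tensor_ker K A B -> fglift f' x = 0.
Proof.
move/asboolP/(_ [pred x | fglift f' x == 0]) => kerP; apply/eqP/kerP.
  split=> [|k u v]; rewrite !inE ?linear0 // => /eqP fu /eqP fv.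
  by rewrite linearP /= fu fv scaler0 addr0.
move=> _ [a a' b|a b b'|k a b|k a b]; rewrite inE linearB /=;
  rewrite ?linearD ?linearZ /= !liftU !scale1r /f' /=.
- by rewrite linearDl -opprD subrr.
- by rewrite linearDr -opprD subrr.
- by rewrite linearZl_LR scalerN subrr.
- by rewrite linearZr_LR scalerN subrr.
Qed.

Lemma tensor_lift_pi x : tensor_lift (tensor_pi x) = fglift f' x.
Proof.
apply/eqP; rewrite -subr_eq0 -linearB; apply/eqP/fglift_ker.
by rewrite -tensor_pi_eq tensor_piK.
Qed.

Lemma tensor_lift_linear : linear tensor_lift.
Proof.
move=> k x y; rewrite -(tensor_piK x) -(tensor_piK y).
by rewrite -tensor_piZ -tensor_piD !tensor_lift_pi linearP.
Qed.

HB.instance Definition _ :=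
  GRing.isLinear.Build K (A ⊗ B) W *:%R tensor_lift tensor_lift_linear.

Lemma tensor_liftE a b : tensor_lift (a *t b) = f a b.
Proof. by rewrite tensor_lift_pi liftU scale1r. Qed.

End Lift.

Arguments tensor_lift : simpl never.

Section Map.
Variables (K : fieldType) (A B C D : lmodType K).
Variables (f : {linear A -> C}) (g : {linear B -> D}).

Let map_pure (a : A) (b : B) : C ⊗ D := f a *t g b.

Fact map_pure_bilinear : bilinear_for *:%R *:%R map_pure.
Proof.
split=> [b k a a' | a k b b']; rewrite /map_pure /=.
  by rewrite linearP linearDl linearZl_LR.
by rewrite linearP linearDr linearZr_LR.
Qed.

HB.instance Definition _ :=
  bilinear_isBilinear.Build K A B (C ⊗ D) *:%R *:%R map_pure map_pure_bilinear.

Definition tensor_map : A ⊗ B -> C ⊗ D := tensor_lift map_pure.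
HB.instance Definition _ := GRing.Linear.on tensor_map.

Lemma tensor_mapE a b : tensor_map (a *t b) = f a *t g b.
Proof. exact: tensor_liftE. Qed.

End Map.

Arguments tensor_map : simpl never.

Section Flip.
Variables (K : fieldType) (A B : lmodType K).

Let flip_pure (a : A) (b : B) : B ⊗ A := b *t a.

Fact flip_pure_bilinear : bilinear_for *:%R *:%R flip_pure.
Proof.
split=> [b k a a' | a k b b']; rewrite /flip_pure /=.
  by rewrite linearDr linearZr_LR.
by rewrite linearDl linearZl_LR.
Qed.

HB.instance Definition _ :=
  bilinear_isBilinear.Build K A B (B ⊗ A) *:%R *:%R flip_pure
    flip_pure_bilinear.

Definition tau : A ⊗ B -> B ⊗ A := tensor_lift flip_pure.
HB.instance Definition _ := GRing.Linear.on tau.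

Lemma tauE a b : tau (a *t b) = b *t a.
Proof. exact: tensor_liftE. Qed.

End Flip.

Arguments tau {K} A B _ : simpl never.

Section Associator.
Variables (K : fieldType) (A B C : lmodType K).

Let assoc_pure (c : C) (a : A) (b : B) : A ⊗ (B ⊗ C) := a *t (b *t c).

Fact assoc_pure_bilinear c : bilinear_for *:%R *:%R (assoc_pure c).
Proof.
split=> [b k a a' | a k b b']; rewrite /assoc_pure /=.
  by rewrite linearDl linearZl_LR.
by rewrite linearDl linearZl_LR linearDr linearZr_LR.
Qed.

HB.instance Definition _ c :=
  bilinear_isBilinear.Build K A B (A ⊗ (B ⊗ C)) *:%R *:%R (assoc_pure c)
    (assoc_pure_bilinear c).

Let assoc_pair (x : A ⊗ B) (c : C) : A ⊗ (B ⊗ C) :=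
  tensor_lift (assoc_pure c) x.

Fact assoc_pair_bilinear : bilinear_for *:%R *:%R assoc_pair.
Proof.
split=> [c k x x' | x k c c']; rewrite /assoc_pair /=; first exact: linearP.
elim/tensor_ind: x => [a b|x y IHx IHy|l x IHx].
- by rewrite !tensor_liftE /= /assoc_pure !linearDr !linearZr_LR.
- by rewrite !linearD /= IHx IHy ?scalerDr addrACA.
- by rewrite !linearZ /= IHx ?scalerDr !scalerA mulrC.
Qed.

HB.instance Definition _ :=
  bilinear_isBilinear.Build K (A ⊗ B) C (A ⊗ (B ⊗ C)) *:%R *:%R assoc_pair
    assoc_pair_bilinear.

Definition assoc : A ⊗ B ⊗ C -> A ⊗ (B ⊗ C) := tensor_lift assoc_pair.
HB.instance Definition _ := GRing.Linear.on assoc.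

Lemma assocE a b c : assoc (a *t b *t c) = a *t (b *t c).
Proof. by rewrite [LHS]tensor_liftE [LHS]tensor_liftE. Qed.

End Associator.

Arguments assoc {K} A B C _ : simpl never.

Section AssociatorInverse.
Variables (K : fieldType) (A B C : lmodType K).

(* The inverse A ⊗ (B ⊗ C) -> (A ⊗ B) ⊗ C, obtained from [assoc] by reversing
   the order of the factors. *)
Definition unassoc : A ⊗ (B ⊗ C) -> A ⊗ B ⊗ C :=
  tau C (A ⊗ B) \o tensor_map idfun (tau B A) \o assoc C B A
    \o tensor_map (tau B C) idfun \o tau A (B ⊗ C).
HB.instance Definition _ := GRing.Linear.on unassoc.

Lemma unassocE a b c : unassoc (a *t (b *t c)) = a *t b *t c.
Proof.
by rewrite /unassoc /= tauE tensor_mapE /= tauE assocE tensor_mapE /= !tauE.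
Qed.

Lemma assocK : cancel (assoc A B C) unassoc.
Proof.
apply: tensor_ind => [x c|x y IHx IHy|k x IHx]; last first.
- by rewrite !linearZ /= IHx.
- by rewrite !linearD /= IHx IHy.
elim/tensor_ind: x => [a b|x y IHx IHy|k x IHx].
- by rewrite assocE unassocE.
- by rewrite linearDl !linearD /= IHx IHy.
- by rewrite linearZl_LR !linearZ /= IHx.
Qed.

Lemma unassocK : cancel unassoc (assoc A B C).
Proof.
apply: tensor_ind => [a x|x y IHx IHy|k x IHx]; last first.
- by rewrite !linearZ /= IHx.
- by rewrite !linearD /= IHx IHy.
elim/tensor_ind: x => [b c|x y IHx IHy|k x IHx].
- by rewrite unassocE assocE.
- by rewrite linearDr !linearD /= IHx IHy.
- by rewrite linearZr_LR !linearZ /= IHx.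
Qed.

End AssociatorInverse.

Arguments unassoc {K} A B C _ : simpl never.

(* Throughout, A ⊗ A ⊗ A is bracketed to the left and the canonical
   isomorphism [assoc] is written explicitly: [tensor_idr F] is F ⊗ Id and
   [tensor_idl F] is Id ⊗ F. *)
Section Threefold.
Variables (K : fieldType) (A : lmodType K).

Definition tensor_idr (F : {linear A ⊗ A -> A ⊗ A}) :
    A ⊗ A ⊗ A -> A ⊗ A ⊗ A :=
  tensor_map F idfun.
HB.instance Definition _ F := GRing.Linear.on (tensor_idr F).

Definition tensor_idl (F : {linear A ⊗ A -> A ⊗ A}) :
    A ⊗ A ⊗ A -> A ⊗ A ⊗ A :=
  unassoc A A A \o tensor_map idfun F \o assoc A A A.
HB.instance Definition _ F := GRing.Linear.on (tensor_idl F).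

Definition is_lEAS (Phi : {linear A ⊗ A -> A ⊗ A}) : Prop :=
  tensor_idl Phi \o tensor_idr Phi \o tensor_idl Phi
    =1 tensor_idr Phi \o tensor_idl (tau A A) \o tensor_idr Phi.

(* The product of A ⊗ A: (a *t b, c *t d) |-> m (a *t c) *t m (b *t d), i.e.
   (m ⊗ m) o (Id ⊗ tau ⊗ Id). *)
Definition tensor_mul (m : {linear A ⊗ A -> A}) :
    (A ⊗ A) ⊗ (A ⊗ A) -> A ⊗ A :=
  tensor_map m m \o assoc (A ⊗ A) A A
    \o tensor_map (tensor_idl (tau A A)) idfun \o unassoc (A ⊗ A) A A.
HB.instance Definition _ m := GRing.Linear.on (tensor_mul m).

Lemma tensor_mulE m a b c d :
  tensor_mul m ((a *t b) *t (c *t d)) = m (a *t c) *t m (b *t d).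
Proof.
rewrite /tensor_mul /= unassocE tensor_mapE /= /tensor_idl /=.
rewrite assocE tensor_mapE /= tauE.
by rewrite unassocE assocE tensor_mapE.
Qed.

Record is_bialgebra (m : {linear A ⊗ A -> A}) (Delta : {linear A -> A ⊗ A}) :
    Prop := IsBialgebra {
  bialgebra_assoc :
    m \o tensor_map m idfun =1 m \o tensor_map idfun m \o assoc A A A;
  bialgebra_coassoc :
    assoc A A A \o tensor_map Delta idfun \o Delta
      =1 tensor_map idfun Delta \o Delta;
  bialgebra_multiplicative : forall x y : A,
    Delta (m (x *t y)) = tensor_mul m (Delta x *t Delta y)
}.

Definition bialgebra_Phi (m : {linear A ⊗ A -> A})
    (Delta : {linear A -> A ⊗ A}) : A ⊗ A -> A ⊗ A :=
  tensor_map m idfun \o tensor_idl (tau A A) \o tensor_map Delta idfun.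
HB.instance Definition _ m Delta := GRing.Linear.on (bialgebra_Phi m Delta).

(* The formula in Sweedler's notation. *)
Lemma bialgebra_PhiE (m : {linear A ⊗ A -> A}) (Delta : {linear A -> A ⊗ A})
    (a b : A) (I : Type) (r : seq I) (a1 a2 : I -> A) :
  Delta a = \sum_(i <- r) a1 i *t a2 i ->
  bialgebra_Phi m Delta (a *t b) = \sum_(i <- r) m (a1 i *t b) *t a2 i.
Proof.
move=> Da; rewrite /bialgebra_Phi /tensor_idl /= tensor_mapE Da.
rewrite linear_sumlz !linear_sum; apply: eq_bigr => i _ /=.
by rewrite assocE tensor_mapE /= tauE unassocE tensor_mapE.
Qed.

End Threefold.

(* Main.v *)
Require Import Defs.
From HB Require Import structures.
From mathcomp Require Import all_boot all_order all_algebra.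

Set Implicit Arguments.
Unset Strict Implicit.
Unset Printing Implicit Defensive.

Import GRing.Theory.
Local Open Scope ring_scope.

(** Write [u . v] for the product [tensor_mul m] of A ⊗ A.  Multiplicativity
    of [Delta] and associativity of [m] make [Phi] a morphism of left
    A-modules, where A acts on the first factor of the source and through
    [Delta] on the target: Phi(xy ⊗ z) = Delta(x) . Phi(y ⊗ z)
    ([bialgebra_Phi_mull]).

    Fix [a], [b], [c] and put w = Phi(b ⊗ c).  The right-hand side of the
    identity sends a ⊗ b ⊗ c to the sum of the Phi(a1 b ⊗ c) ⊗ a2, which by this
    module property is the sum of the Delta(a1) . w ⊗ a2, i.e. the image of
    (Delta ⊗ Id) Delta(a) under R_w ⊗ Id, with R_w the right multiplication by
    [w].  The left-hand side first produces a ⊗ w, and a computation on pure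
    tensors shows that, for every [w] in A ⊗ A, its two other factors turn
    a ⊗ w into the image of (Id ⊗ Delta) Delta(a) under the same map R_w ⊗ Id
    ([bialgebra_Phi_braid_left]).  Coassociativity identifies the two. *)

Section BialgebraPhi.
Variables (K : fieldType) (A : lmodType K).
Variables (m : {linear A ⊗ A -> A}) (Delta : {linear A -> A ⊗ A}).

Local Notation Phi := (bialgebra_Phi m Delta).

Definition tensor_mulr (w u : A ⊗ A) : A ⊗ A := tensor_mul m (u *t w).

Fact tensor_mulr_linear w : linear (tensor_mulr w).
Proof.
by move=> k u v; rewrite /tensor_mulr linearDl linearZl_LR linearP.
Qed.

HB.instance Definition _ w :=
  GRing.isLinear.Build K (A ⊗ A) (A ⊗ A) *:%R (tensor_mulr w)
    (tensor_mulr_linear w).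

(** The map R_w ⊗ Id applied to [t], seen as a function of [w] so that its
    linearity in [w] is available for reductions to a pure [w]. *)
Definition tensor_mulr_idr (t : A ⊗ A ⊗ A) (w : A ⊗ A) : A ⊗ A ⊗ A :=
  tensor_map (tensor_mulr w) idfun t.

Fact tensor_mulr_idr_linear t : linear (tensor_mulr_idr t).
Proof.
move=> k w w'; rewrite /tensor_mulr_idr.
elim/tensor_ind: t => [u z|s t IHs IHt|l t IHt].
- rewrite !tensor_mapE /= /tensor_mulr linearDr linearZr_LR linearP /=.
  by rewrite linearDl linearZl_LR.
- by rewrite !linearD /= IHs IHt addrACA.
- by rewrite !linearZ /= IHt scalerDr !scalerA mulrC.
Qed.

HB.instance Definition _ t :=
  GRing.isLinear.Build K (A ⊗ A) (A ⊗ A ⊗ A) *:%R (tensor_mulr_idr t)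
    (tensor_mulr_idr_linear t).

(** The factor of Phi = mul_outer o (Delta ⊗ Id) that does not involve
    [Delta]; naming it lets Delta(a) be replaced by an arbitrary element of
    A ⊗ A, hence by a pure tensor. *)
Definition mul_outer : A ⊗ A ⊗ A -> A ⊗ A :=
  tensor_map m idfun \o tensor_idl (tau A A).
HB.instance Definition _ := GRing.Linear.on mul_outer.

Lemma mul_outerE x y z : mul_outer (x *t y *t z) = m (x *t z) *t y.
Proof.
rewrite /mul_outer /tensor_idl /= assocE tensor_mapE /= tauE.
by rewrite unassocE tensor_mapE.
Qed.

Lemma bialgebra_Phi_pure a b : Phi (a *t b) = mul_outer (Delta a *t b).
Proof. by rewrite /bialgebra_Phi /= tensor_mapE. Qed.

Lemma tensor_idrE (F : {linear A ⊗ A -> A ⊗ A}) u c :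
  tensor_idr F (u *t c) = F u *t c.
Proof. exact: tensor_mapE. Qed.

Lemma tensor_idlE (F : {linear A ⊗ A -> A ⊗ A}) a b c :
  tensor_idl F (a *t b *t c) = unassoc A A A (a *t F (b *t c)).
Proof. by rewrite /tensor_idl /= assocE tensor_mapE. Qed.

(** Right multiplication of the first factor by [c] commutes with left
    multiplication by [u]: on pure tensors this is associativity of [m] in the
    first factor, while the second factors agree literally. *)
Lemma mul_outer_mull (mA : m \o tensor_map m idfun
    =1 m \o tensor_map idfun m \o assoc A A A) u v c :
  mul_outer (tensor_mul m (u *t v) *t c)
    = tensor_mul m (u *t mul_outer (v *t c)).
Proof.
elim/tensor_ind: u => [x y|u u' IHu IHu'|k u IHu]; last first.
- by rewrite !(linearZl_LR, linearZ) /= IHu.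
- by rewrite !(linearDl, linearD) /= IHu IHu'.
elim/tensor_ind: v => [x' y'|v v' IHv IHv'|k v IHv]; last first.
- by rewrite linearZr_LR linearZ !linearZl_LR !linearZ linearZr_LR linearZ /= IHv.
- by rewrite linearDr linearD !linearDl !linearD linearDr linearD /= IHv IHv'.
rewrite tensor_mulE !mul_outerE tensor_mulE; congr (_ *t _).
by have := mA (x *t x' *t c); rewrite /= assocE !tensor_mapE.
Qed.

(** Phi is left A-linear, A acting on the target through [Delta]: expand
    Delta(xy) = Delta(x) . Delta(y), then use that right multiplication by [z]
    on the first factor commutes with left multiplication by Delta(x). *)
Lemma bialgebra_Phi_mull (mD : is_bialgebra m Delta) x y z :
  Phi (m (x *t y) *t z) = tensor_mul m (Delta x *t Phi (y *t z)).
Proof.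
case: mD => mA _ Dm.
by rewrite !bialgebra_Phi_pure Dm mul_outer_mull.
Qed.

(** On w = p ⊗ q both sides are the sum of a1 p ⊗ (a2)1 q ⊗ (a2)2.  The
    statement is for a general [w] because it is applied to
    w = Phi(b ⊗ c), which need not be pure. *)
Lemma bialgebra_Phi_braid_left a w :
  tensor_idl Phi (tensor_idr Phi (unassoc A A A (a *t w)))
    = tensor_mulr_idr (unassoc A A A (tensor_map idfun Delta (Delta a))) w.
Proof.
elim/tensor_ind: w => [p q|w w' IHw IHw'|k w IHw]; last first.
- by rewrite linearZr_LR !linearZ /= IHw.
- by rewrite linearDr !linearD /= IHw IHw'.
rewrite /tensor_mulr_idr unassocE tensor_idrE /= bialgebra_Phi_pure.
elim/tensor_ind: (Delta a) => [x y|u u' IHu IHu'|k u IHu]; last first.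
- by rewrite !(linearZl_LR, linearZ) /= IHu.
- by rewrite !(linearDl, linearD) /= IHu IHu'.
rewrite mul_outerE tensor_idlE tensor_mapE /= bialgebra_Phi_pure.
elim/tensor_ind: (Delta y) => [y1 y2|u u' IHu IHu'|k u IHu]; last first.
- by rewrite linearZl_LR linearZ !linearZr_LR !linearZ /= IHu.
- by rewrite linearDl linearD !linearDr !linearD /= IHu IHu'.
by rewrite mul_outerE !unassocE tensor_mapE /= /tensor_mulr tensor_mulE.
Qed.

(** With Delta(a) the sum of the a1 ⊗ a2, the first two maps give the sum of the
    a1 b ⊗ c ⊗ a2, and the module property of [Phi] pulls a1 out of
    Phi(a1 b ⊗ c). *)
Lemma bialgebra_Phi_braid_right (mD : is_bialgebra m Delta) a b c :
  tensor_idr Phi (tensor_idl (tau A A) (tensor_idr Phi (a *t b *t c)))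
    = tensor_mulr_idr (tensor_map Delta idfun (Delta a)) (Phi (b *t c)).
Proof.
rewrite /tensor_mulr_idr tensor_idrE /= bialgebra_Phi_pure.
elim/tensor_ind: (Delta a) => [x y|u u' IHu IHu'|k u IHu]; last first.
- by rewrite !(linearZl_LR, linearZ) /= IHu.
- by rewrite !(linearDl, linearD) /= IHu IHu'.
rewrite mul_outerE tensor_idlE /= tauE unassocE tensor_idrE !tensor_mapE /=.
by rewrite bialgebra_Phi_mull.
Qed.

End BialgebraPhi.

Theorem proposition5p1 (K : fieldType) (A : lmodType K)
    (m : {linear A ⊗ A -> A}) (Delta : {linear A -> A ⊗ A}) :
  is_bialgebra m Delta -> is_lEAS (bialgebra_Phi m Delta).
Proof.
move=> mD; rewrite /is_lEAS.
apply: tensor_ext => u c.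
elim/tensor_ind: u => [a b|u u' IHu IHu'|k u IHu]; last first.
- by rewrite linearZl_LR !linearZ IHu.
- by rewrite linearDl !linearD IHu IHu'.
rewrite /= bialgebra_Phi_braid_right // tensor_idlE bialgebra_Phi_braid_left.
by have /= <- := bialgebra_coassoc mD a; rewrite assocK.
Qed.
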